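(* Let $d$ be prime, $n\ge1$, $G$ positive and invertible over $\mathbb Z_d$, $\sigma$ an $n$-qudit state, and $\mathcal E_\sigma(\rho)=\rho\boxtimes\sigma$. Then $$n\log d-H(\mathcal M(\sigma))\le\chi_H(\mathcal E_\sigma)\le n\log d-H(\sigma).$$ In particular, if $\sigma$ is an MSPS then $\chi_H(\mathcal E_\sigma)=n\log d-H(\sigma)$.
   Context: Fix a prime $d$; $\chi(k)=e^{2\pi ik/d}$, $X|k\rangle=|k+1\rangle$, $Z|k\rangle=\chi(k)|k\rangle$ on $\mathbb C^d$; Weyl operators $w(p,q)=\chi(-2^{-1}pq)Z^pX^q$ (odd $d$), $w(p,q)=i^{-pq}Z^pX^q$ ($d=2$), $w(\vec p,\vec q)=\bigotimes_kw(p_k,q_k)$; characteristic function $\Xi_\rho(\vec p,\vec q)=\mathrm{Tr}[\rho\,w(-\vec p,-\vec q)]$. The mean state $\mathcal M(\rho)$ has $\Xi_{\mathcal M(\rho)}(\vec x)=\Xi_\rho(\vec x)$ if $|\Xi_\rho(\vec x)|=1$ and $0$ otherwise. An MSPS is a minimal projection of the C*-algebra generated by an abelian group of Weyl operators, divided by its rank. $G=\begin{pmatrix}g_{00}&g_{01}\\ g_{10}&g_{11}\end{pmatrix}$ over $\mathbb Z_d$, $\det G\not\equiv0$, $N=(\det G)^{-1}$; positive means all entries nonzero mod $d$. Key unitary $U|\vec i\rangle|\vec j\rangle=|Ng_{11}\vec i-Ng_{10}\vec j\rangle|-Ng_{01}\vec i+Ng_{00}\vec j\rangle$; $\rho\boxtimes\sigma=\mathrm{Tr}_B[U(\rho\otimes\sigma)U^\dagger]$.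 Holevo capacity: $\chi_H(\mathcal E)=\max_{\{p_i,\rho_i\}}\big[H(\sum_ip_i\mathcal E(\rho_i))-\sum_ip_iH(\mathcal E(\rho_i))\big]$ over ensembles of input states; $H$ is von Neumann entropy. *)

(* Defs.v *)
From HB Require Import structures.
From mathcomp Require Import all_boot all_order all_algebra.
From mathcomp Require Import all_classical all_reals all_analysis.
From mathcomp Require Import complex.
Set Implicit Arguments. Unset Strict Implicit. Unset Printing Implicit Defensive.
Import Order.TTheory GRing.Theory Num.Theory.
Local Open Scope ring_scope.
Local Open Scope complex_scope.

(* computational basis labels of n qudits: vectors in (Z_d)^n *)
Notation qv d n := {ffun 'I_n -> 'F_d}.
Definition dimq (d n : nat) : nat := #|{: qv d n}|.
(* operators on (C^d)^{(x) n}, rows/columns indexed by enum_rank of labels *)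
Notation op R d n := 'M[R[i]]_(dimq d n).

Definition lab (d n : nat) (i : 'I_(dimq d n)) : qv d n := enum_val i.

Definition ent (R : realType) (d n : nat) (A : op R d n) (x y : qv d n) : R[i] :=
  A (enum_rank x) (enum_rank y).

Definition adj (R : realType) (m k : nat) (A : 'M[R[i]]_(m, k)) : 'M[R[i]]_(k, m) :=
  (map_mx (@conjc R) A)^T.

Definition is_state (R : realType) (d n : nat) (A : op R d n) : Prop :=
  [/\ adj A = A,
      forall v : 'cV[R[i]]_(dimq d n), 0 <= (adj v *m A *m v) ord0 ord0
    & \tr A = 1].

Definition chi (R : realType) (d : nat) (k : 'F_d) : R[i] :=
  (cos (2 * pi * (nat_of_ord k)%:R / d%:R)) +i* (sin (2 * pi * (nat_of_ord k)%:R / d%:R)).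

Definition wphase (R : realType) (d : nat) (p q : 'F_d) : R[i] :=
  if d == 2%N then (- 'i) ^+ (nat_of_ord p * nat_of_ord q)%N
  else chi R (- (2%:R)^-1 * p * q).

(* <x| w(p,q) |y> = phase * <x| Z^p X^q |y>, with Z^p X^q |y> = chi(p(y+q)) |y+q> *)
Definition w1 (R : realType) (d : nat) (p q x y : 'F_d) : R[i] :=
  wphase R p q * chi R (p * x) * (x == y + q)%:R.

Definition weyl (R : realType) (d n : nat) (p q : qv d n) : op R d n :=
  \matrix_(i, j) \prod_(k < n) w1 R (p k) (q k) (lab i k) (lab j k).

Definition charf (R : realType) (d n : nat) (rho : op R d n) (p q : qv d n) : R[i] :=
  \tr (rho *m weyl R (- p) (- q)).

Definition meanState (R : realType) (d n : nat) (rho : op R d n) : op R d n :=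
  xget 0 [set tau : op R d n | forall p q : qv d n,
     charf tau p q = if `|charf rho p q| == 1 then charf rho p q else 0].

Definition positiveG (d : nat) (G : 'M['F_d]_2) : Prop :=
  forall i j, G i j != 0.

Definition keyperm (d n : nat) (G : 'M['F_d]_2) (ij : qv d n * qv d n) : qv d n * qv d n :=
  let N := (\det G)^-1 in
  ([ffun k => N * G ord_max ord_max * ij.1 k - N * G ord_max ord0 * ij.2 k],
   [ffun k => - (N * G ord0 ord_max * ij.1 k) + N * G ord0 ord0 * ij.2 k]).

Definition keyU (R : realType) (d n : nat) (G : 'M['F_d]_2) (x x' : qv d n * qv d n) : R[i] :=
  (x == keyperm G x')%:R.

(* rho boxtimes sigma = Tr_B [ U (rho (x) sigma) U^dagger ] *)
Definition boxprod (R : realType) (d n : nat) (G : 'M['F_d]_2) (rho sigma : op R d n) : op R d n :=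
  \matrix_(i, j) \sum_(b : qv d n) \sum_(x' : qv d n * qv d n) \sum_(y' : qv d n * qv d n)
     keyU R G (lab i, b) x' * (ent rho x'.1 y'.1 * ent sigma x'.2 y'.2)
       * conjc (keyU R G (lab j, b) y').

Definition eigs (R : realType) (m : nat) (A : 'M[R[i]]_m) : seq R[i] :=
  xget [::] [set s : seq R[i] | char_poly A = \prod_(z <- s) ('X - z%:P)].

(* von Neumann entropy H(rho) = - sum_lambda lambda ln lambda (natural log;
   0 ln 0 = 0 since ln 0 = 0 in MathComp-Analysis) *)
Definition vN (R : realType) (m : nat) (A : 'M[R[i]]_m) : R :=
  - \sum_(z <- eigs A) complex.Re z * ln (complex.Re z).

Definition holevo_vals (R : realType) (d n : nat) (E : op R d n -> op R d n) : set R :=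
  [set x | exists (k : nat) (p : 'I_k -> R) (rho : 'I_k -> op R d n),
      [/\ forall i, 0 <= p i, \sum_i p i = 1, forall i, is_state (rho i) &
          x = vN (\sum_i (p i)%:C *: E (rho i)) - \sum_i p i * vN (E (rho i))]].

(* Holevo capacity (the max over ensembles, taken as a supremum) *)
Definition holevo (R : realType) (d n : nat) (E : op R d n -> op R d n) : R :=
  sup (holevo_vals E).

Definition abelian_weyl_group (R : realType) (d n : nat) (S : {set qv d n * qv d n}) : Prop :=
  [/\ 0 \in S, (forall x y, x \in S -> y \in S -> x - y \in S) &
      forall x y, x \in S -> y \in S ->
        weyl R x.1 x.2 *m weyl R y.1 y.2 = weyl R y.1 y.2 *m weyl R x.1 x.2].

(* the C*-algebra generated by {w(x) : x in S} (the span of these operators) *)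
Definition in_weyl_alg (R : realType) (d n : nat) (S : {set qv d n * qv d n}) (A : op R d n) : Prop :=
  exists c : qv d n * qv d n -> R[i], A = \sum_(x in S) c x *: weyl R x.1 x.2.

Definition is_proj (R : realType) (m : nat) (P : 'M[R[i]]_m) : Prop :=
  P *m P = P /\ adj P = P.

Definition minimal_proj (R : realType) (d n : nat) (S : {set qv d n * qv d n}) (P : op R d n) : Prop :=
  [/\ in_weyl_alg S P, is_proj P, P != 0 &
      forall Q, in_weyl_alg S Q -> is_proj Q -> Q *m P = Q -> Q = 0 \/ Q = P].

Definition isMSPS (R : realType) (d n : nat) (sigma : op R d n) : Prop :=
  exists (S : {set qv d n * qv d n}) (P : op R d n),
    [/\ abelian_weyl_group R S, minimal_proj S P & sigma = ((\rank P)%:R)^-1 *: P].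

(* Main.v *)
Require Import Defs.
From HB Require Import structures.
From mathcomp Require Import all_boot all_order all_algebra.
From mathcomp Require Import all_classical all_reals all_analysis.
From mathcomp Require Import complex.
From mathcomp Require Import ring lra.
Import Order.TTheory GRing.Theory Num.Theory.
Local Open Scope ring_scope.
Local Open Scope complex_scope.

Set Implicit Arguments.
Unset Strict Implicit.
Unset Printing Implicit Defensive.

(** Positivity forces [d] to be odd: over F_2 the only positive [G] is singular.

    Upper bound: for a fixed state [rho], the map [sigma |-> rho [x] sigma] is
    linear, positive, trace preserving and unital, so it acts on spectra by a
    doubly stochastic matrix and does not decrease the entropy; output
    averages have entropy at most [n log d].

    Lower bound: [xi (rho [x] sigma) = (xi rho o L1) * (xi sigma o L2)] for two
    invertible diagonal maps [L1], [L2] of phase space. The set [S] where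
    [|xi sigma| = 1] is an isotropic subgroup and [xi sigma] is a character of
    it. The probes are the stabilizer states on [L1 (L2^-1 S)] twisted by all
    characters [x |-> chi (u . x)]; their images are stabilizer states on
    [L2^-1 S], of the same entropy as the mean state, and average to the
    maximally mixed state.

    A minimal projection of the algebra of [S] is a multiple of a twisted
    stabilizer state on [S], hence an MSPS is its own mean state. *)

(** * Adjoints and the Hilbert-Schmidt norm *)

Section Adjoint.
Context {R : realType}.
Implicit Types (m k l : nat).

Lemma conjcM (x y : R[i]) : conjc (x * y) = conjc x * conjc y.
Proof. exact: rmorphM. Qed.

Lemma adjE m k (A : 'M[R[i]]_(m, k)) i j : adj A i j = conjc (A j i).
Proof. by rewrite !mxE. Qed.

Lemma adjK m k (A : 'M[R[i]]_(m, k)) : adj (adj A) = A.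
Proof. by apply/matrixP => i j; rewrite !adjE conjcK. Qed.

Lemma adjM m k l (A : 'M[R[i]]_(m, k)) (B : 'M[R[i]]_(k, l)) :
  adj (A *m B) = adj B *m adj A.
Proof. by rewrite /adj map_mxM trmx_mul. Qed.

Lemma adj_scale m k c (A : 'M[R[i]]_(m, k)) : adj (c *: A) = conjc c *: adj A.
Proof. by apply/matrixP => i j; rewrite !mxE rmorphM. Qed.

Lemma adjB m k (A B : 'M[R[i]]_(m, k)) : adj (A - B) = adj A - adj B.
Proof. by apply/matrixP => i j; rewrite !mxE rmorphB. Qed.

Lemma adj_id m : adj (1%:M : 'M[R[i]]_m) = 1%:M.
Proof. by apply/matrixP => i j; rewrite !mxE eq_sym rmorph_nat. Qed.

Lemma adj_sum m k (I : finType) (P : pred I) (F : I -> 'M[R[i]]_(m, k)) :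
  adj (\sum_(i | P i) F i) = \sum_(i | P i) adj (F i).
Proof.
by apply/matrixP => i j; rewrite adjE !summxE rmorph_sum; apply: eq_bigr => ? _; rewrite adjE.
Qed.

Lemma diag_adjM m k (A : 'M[R[i]]_(m, k)) i :
  (adj A *m A) i i = \sum_j `|A j i| ^+ 2.
Proof. by rewrite mxE; apply: eq_bigr => j _; rewrite adjE sqr_normc mulrC. Qed.

Lemma tr_adjM m k (A : 'M[R[i]]_(m, k)) : \tr (adj A *m A) = \sum_i \sum_j `|A j i| ^+ 2.
Proof. by apply: eq_bigr => i _; rewrite diag_adjM. Qed.

Lemma tr_adjM_eq0 m k (A : 'M[R[i]]_(m, k)) : \tr (adj A *m A) = 0 -> A = 0.
Proof.
rewrite tr_adjM => /eqP; rewrite psumr_eq0 => [/allP H|i _]; last first.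
  by apply: sumr_ge0 => j _; rewrite exprn_ge0.
apply/matrixP => j i; have /implyP/(_ isT) := H i (mem_index_enum _).
rewrite psumr_eq0 => [/allP/(_ j (mem_index_enum _))/implyP/(_ isT)|? _]; last by rewrite exprn_ge0.
by rewrite mxE expf_eq0 /= normr_eq0 => /eqP.
Qed.

End Adjoint.

(** * Positive semidefinite matrices, their spectra and the von Neumann entropy *)

Section Spectral.
Context {R : realType}.

Definition psd m (A : 'M[R[i]]_m) : Prop :=
  adj A = A /\ forall v : 'cV[R[i]]_m, 0 <= (adj v *m A *m v) ord0 ord0.

Lemma psd_adjM m k (A : 'M[R[i]]_(m, k)) : psd (adj A *m A).
Proof.
split=> [|v]; first by rewrite adjM adjK.
rewrite mulmxA -adjM -mulmxA diag_adjM.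
by apply: sumr_ge0 => j _; rewrite exprn_ge0.
Qed.

Lemma psdZ m (c : R) (A : 'M[R[i]]_m) : 0 <= c -> psd A -> psd (c%:C *: A).
Proof.
move=> c0 [A1 A2]; split=> [|v]; first by rewrite adj_scale A1 conjc_real.
by rewrite -scalemxAr -scalemxAl mxE mulr_ge0 // ler0c.
Qed.

Lemma psdD m (A B : 'M[R[i]]_m) : psd A -> psd B -> psd (A + B).
Proof.
move=> [A1 A2] [B1 B2]; split=> [|v].
  by rewrite -[B]opprK adjB -{1}[B]scale1r -scaleNr adj_scale A1 B1 rmorphN rmorph1 scaleN1r.
by rewrite mulmxDr mulmxDl mxE addr_ge0.
Qed.

Lemma psd0 m : psd (0 : 'M[R[i]]_m).
Proof. by have := psd_adjM (0 : 'M[R[i]]_m); rewrite mulmx0. Qed.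

Lemma psd_sum m (I : finType) (F : I -> 'M[R[i]]_m) :
  (forall i, psd (F i)) -> psd (\sum_i F i).
Proof. by move=> h; elim/big_ind: _ => [|A B|i _]; [exact: psd0 | exact: psdD | exact: h]. Qed.

Lemma psd_spectral m (A : 'M[R[i]]_m) : psd A ->
  exists (U : 'M[R[i]]_m) (a : 'I_m -> R),
    [/\ U *m adj U = 1%:M, adj U *m U = 1%:M, forall i, 0 <= a i &
        A = adj U *m diag_mx (\row_i (a i)%:C) *m U].
Proof.
move=> [A1 A2].
have hA : A \is hermsymmx.
  by apply/is_hermitianmxP; rewrite expr0 scale1r -map_trmx -[RHS]/(adj A) A1.
have uU := spectral_unitarymx A.
have := orthomx_spectralP (hermitian_normalmx hA).
have rd := hermitian_spectral_diag_real hA.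
rewrite (invmx_unitary uU); set U := spectralmx A in uU *; set s := spectral_diag A in rd *.
have eU : map_mx Num.conj (trmx U) = adj U by rewrite -map_trmx.
rewrite eU => eA.
have U1 : U *m adj U = 1%:M by rewrite -eU; apply/unitarymxP.
exists U, (fun i => complex.Re (s ord0 i)).
have es : \row_i (complex.Re (s ord0 i))%:C = s.
  by apply/rowP => i; rewrite mxE RRe_real // (mxOverP rd).
split; [exact: U1 | exact: mulmx1C | move=> i | by rewrite es].
(* Evaluating the quadratic form at the [i]-th eigenvector isolates the [i]-th eigenvalue. *)
have := A2 (adj (row i U)); rewrite adjK {1}eA.
have -> : row i U *m (adj U *m diag_mx s *m U) *m adj (row i U) =
          row i (U *m adj U) *m diag_mx s *m adj (row i (U *m adj U)).
  by rewrite !row_mul !adjM adjK !mulmxA.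
rewrite U1 row1 mxE (bigD1 i) //= big1 ?addr0; last first.
  by move=> j ji; rewrite mul_mx_diag !mxE !eqxx (negPf ji) /= mul0r mul0r.
rewrite mul_mx_diag !mxE !eqxx !mulr1n rmorph1 mulr1 mul1r => h.
by rewrite -ler0c RRe_real // ger0_real.
Qed.

Lemma psd_factor m (A : 'M[R[i]]_m) : psd A -> exists B : 'M[R[i]]_m, A = adj B *m B.
Proof.
move=> /psd_spectral [U [a [_ _ a0 ->]]].
exists (diag_mx (\row_i (Num.sqrt (a i))%:C) *m U).
rewrite adjM !mulmxA -[_ *m adj _ *m _]mulmxA; congr (_ *m _ *m _).
apply/matrixP => i j; rewrite mul_mx_diag !mxE.
rewrite [i == j]eq_sym; case: eqVneq => [->|_]; last by rewrite !mulr0n rmorph0 mul0r.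
by rewrite !mulr1n conjc_real -rmorphM -expr2 sqr_sqrtr.
Qed.

(** Frees the entropy from the choice made in [eigs]: the characteristic polynomial determines the
    list of its roots up to permutation, so any unitary diagonalization computes [vN]. *)
Lemma vN_spectral m (A U : 'M[R[i]]_m) (a : 'I_m -> R) :
  adj U *m U = 1%:M -> A = adj U *m diag_mx (\row_i (a i)%:C) *m U ->
  vN A = - \sum_i a i * ln (a i).
Proof.
move=> U1 eA.
have cA : char_poly A = \prod_(z <- [seq (a i)%:C | i <- index_enum 'I_m]) ('X - z%:P).
  rewrite big_map.
  have -> : char_poly A = char_poly (diag_mx (\row_i (a i)%:C)).
    rewrite /char_poly.
    have -> : char_poly_mx A = map_mx polyC (adj U) *m
        char_poly_mx (diag_mx (\row_i (a i)%:C)) *m map_mx polyC U.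
      rewrite /char_poly_mx mulmxBr mulmxBl -!map_mxM -eA; congr (_ - _).
      by rewrite mul_mx_scalar -scalemxAl -map_mxM U1 map_mx1 scalemx1.
    by rewrite !det_mulmx mulrAC -det_mulmx -map_mxM U1 map_mx1 det1 mul1r.
  rewrite char_poly_trig ?diag_mx_is_trig //.
  by apply: eq_bigr => i _; rewrite !mxE eqxx mulr1n.
(* The default [[::]] of [xget] is ruled out because [cA] exhibits a valid list of roots. *)
rewrite /vN /eigs; case: xgetP => [s _ /= hs|/(_ _ cA)//].
have /(perm_big _) -> : perm_eq s [seq (a i)%:C | i <- index_enum 'I_m].
  by apply: prod_XsubC_eq; rewrite -cA -hs.
by rewrite big_map.
Qed.

Lemma tr_spectral m (U : 'M[R[i]]_m) (a : 'I_m -> R) :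
  U *m adj U = 1%:M -> \tr (adj U *m diag_mx (\row_i (a i)%:C) *m U) = (\sum_i a i)%:C.
Proof.
move=> U1; rewrite -mulmxA mxtrace_mulC -mulmxA U1 mulmx1 mxtrace_diag rmorph_sum.
by apply: eq_bigr => i _; rewrite mxE.
Qed.

(* Such an [A] is [c] times a projection of trace [1 / c]. *)
Lemma vN_flat m (A : 'M[R[i]]_m) (c : R) : psd A -> \tr A = 1 -> 0 < c ->
  A *m A = c%:C *: A -> vN A = - ln c.
Proof.
move=> /psd_spectral [U [a [U1 U2 a0 eA]]] trA c0 AA.
rewrite (vN_spectral U2 eA); congr (- _).
have suma : \sum_i a i = 1.
  by apply: (@complexI R); rewrite -(tr_spectral _ U1) -eA trA.
have ha i : a i * a i = c * a i.
  have DD : diag_mx (\row_i (a i)%:C) *m diag_mx (\row_i (a i)%:C) =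
       c%:C *: diag_mx (\row_i (a i)%:C).
    have e X : X = U *m (adj U *m X *m U) *m adj U.
      by rewrite !mulmxA U1 mul1mx -mulmxA U1 mulmx1.
    rewrite [LHS]e [RHS]e -scalemxAr -scalemxAl -eA -AA eA; congr (U *m _ *m _).
    by rewrite !mulmxA -[_ *m U *m adj U]mulmxA U1 mulmx1.
  have := congr1 (fun M => fun_of_matrix M i i) DD.
  rewrite mul_mx_diag !mxE eqxx !mulr1n -!rmorphM; exact: complexI.
under eq_bigr => i _.
  have -> : a i * ln (a i) = a i * ln c.
    have [->|ne] := eqVneq (a i) 0; first by rewrite !mul0r.
    by have /(mulIf ne) -> := ha i.
  over.
by rewrite -mulr_suml suma mul1r.
Qed.

End Spectral.

(** * Entropy under doubly stochastic maps *)

Section Entropy.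
Context {R : realType}.

(** The convex function [x ln x] lies above its tangent at [y]. For [x > 0] this is [ln t <= t - 1]
    at [t = y / x]; for [x = 0] it reads [- y <= 0]. *)
Lemma xlnx_tangent (x y : R) : 0 <= x -> 0 < y ->
  y * ln y + (1 + ln y) * (x - y) <= x * ln x.
Proof.
rewrite le_eqVlt => /predU1P[<- y0|x0 y0]; first by rewrite mul0r; lra.
have yx : 0 < y / x by rewrite divr_gt0.
have := @le_ln1Dx R (y / x - 1).
rewrite addrCA subrr addr0 ln_div ?posrE // => /(_ _) h.
have {h} : ln y - ln x <= y / x - 1 by apply: h; lra.
have xy : x * (y / x - 1) = y - x by rewrite mulrBr mulr1 mulrCA mulfV ?mulr1 // gt_eqF.
rewrite -(ler_pM2l x0) xy => h; lra.
Qed.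

(** Jensen's inequality row by row: the tangents at [b i], averaged with weights [D i j], lose their
    linear terms since [b i] is the mean of the [a j]. Column sums then restore the sum over [j]. *)
Lemma sum_xlnx_doubly_stochastic (I : finType) (D : I -> I -> R) (a b : I -> R) :
  (forall i j, 0 <= D i j) -> (forall i, \sum_j D i j = 1) ->
  (forall j, \sum_i D i j = 1) -> (forall j, 0 <= a j) ->
  (forall i, b i = \sum_j D i j * a j) ->
  \sum_i b i * ln (b i) <= \sum_j a j * ln (a j).
Proof.
move=> D0 Dr Dc a0 hb.
have b0 i : 0 <= b i by rewrite hb; apply: sumr_ge0 => j _; rewrite mulr_ge0.
have -> : \sum_j a j * ln (a j) = \sum_i \sum_j D i j * (a j * ln (a j)).
  by rewrite exchange_big; apply: eq_bigr => j _; rewrite -mulr_suml Dc mul1r.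
apply: ler_sum => i _.
(* There is no tangent at 0; but if [b i] vanishes then so does every [D i j * a j], and both sides
   are 0. *)
have [bi0|bi0] := eqVneq (b i) 0.
  rewrite bi0 mul0r big1 // => j _; rewrite mulrA.
  have /eqP := hb i; rewrite bi0 eq_sym psumr_eq0 => [/allP|k _]; last by rewrite mulr_ge0.
  by move=> /(_ j (mem_index_enum _))/implyP/(_ isT)/eqP ->; rewrite mul0r.
have bp : 0 < b i by rewrite lt_def bi0 b0.
have -> : b i * ln (b i) = \sum_j D i j * (b i * ln (b i) + (1 + ln (b i)) * (a j - b i)).
  under eq_bigr do rewrite mulrDr mulrBr mulrBr (mulrCA _ _ (a _)).
  rewrite big_split /= sumrB -!mulr_suml -mulr_sumr -hb Dr; lra.
by apply: ler_sum => j _; rewrite ler_wpM2l // xlnx_tangent.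
Qed.

Lemma vN_le_lnm m (A : 'M[R[i]]_m) : (0 < m)%N -> psd A -> \tr A = 1 ->
  vN A <= ln m%:R.
Proof.
move=> m0 /psd_spectral [U [a [U1 U2 a0 eA]]] trA.
have mp : 0 < m%:R :> R by rewrite ltr0n.
have mn : m%:R != 0 :> R by rewrite gt_eqF.
have suma : \sum_i a i = 1.
  by apply: (@complexI R); rewrite -(tr_spectral _ U1) -eA trA.
have s1 : \sum_(i < m) m%:R^-1 = 1 :> R.
  by rewrite sumr_const card_ord -(mulr_natl (_^-1)) mulfV.
rewrite (vN_spectral U2 eA) lerNl.
(* The constant matrix [1 / m] sends every probability spectrum to the uniform one. *)
have := @sum_xlnx_doubly_stochastic _ (fun _ _ => m%:R^-1) a (fun _ => m%:R^-1).
have -> : \sum_(i < m) (m%:R^-1 * ln m%:R^-1) = - ln (m%:R : R).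
  by rewrite sumr_const card_ord -(mulr_natl (_ * _)) mulrA mulfV // mul1r lnV ?posrE.
apply=> [_ _|i|i|j|i] //; rewrite ?invr_ge0 ?ler0n //; try exact: s1.
by rewrite -mulr_sumr suma mulr1.
Qed.

Lemma vN_unital m (Phi : 'M[R[i]]_m -> 'M[R[i]]_m) (A : 'M[R[i]]_m) :
  linear Phi -> (forall B, psd B -> psd (Phi B)) ->
  Phi 1%:M = 1%:M -> (forall B, \tr (Phi B) = \tr B) ->
  psd A -> vN A <= vN (Phi A).
Proof.
move=> linP posP uniP trP pA.
have P0 : Phi 0 = 0.
  by rewrite -[X in Phi X](addr0) -{1}(scaler0 _ (-1)) linP scaleN1r addrC subrr.
have PD B C : Phi (B + C) = Phi B + Phi C by rewrite -{1}[B]scale1r linP scale1r.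
have PZ c B : Phi (c *: B) = c *: Phi B by rewrite -[c *: B]addr0 linP P0 addr0.
have Psum := big_morph Phi PD P0.
have [V [b [V1 V2 b0 eb]]] := psd_spectral (posP _ pA).
have [U [a [U1 U2 a0 eA]]] := psd_spectral pA.
rewrite (vN_spectral V2 eb) (vN_spectral U2 eA) lerN2.
(* [E j] is the rank-one projection on the [j]-th eigenvector of [A]. *)
pose E j := adj (row j U) *m row j U.
have sumE (c : 'I_m -> R[i]) : adj U *m diag_mx (\row_j c j) *m U = \sum_j c j *: E j.
  apply/matrixP => x y; rewrite summxE !mxE; apply: eq_bigr => j _.
  by rewrite mul_mx_diag !mxE big_ord1 !mxE mulrA [c j * _]mulrC.
have sumE1 : \sum_j E j = 1%:M.
  rewrite -U2 -[adj U in RHS]mulmx1 -[1%:M in RHS]diag_const_mx.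
  have -> : const_mx 1 = \row_(j < m) (1 : R[i]) by apply/rowP => j; rewrite !mxE.
  by rewrite sumE; apply: eq_bigr => j _; rewrite scale1r.
(* The transition matrix from the spectrum of [A] to that of [Phi A]: positivity of [Phi] makes it
   nonnegative, unitality gives row sums 1, trace preservation gives column sums 1. *)
pose q i j := (V *m Phi (E j) *m adj V) i i.
have q0 i j : 0 <= q i j.
  have [_ /(_ (adj (row i V)))] := posP _ (psd_adjM (row j U)).
  rewrite adjK -/(E j) => h; rewrite /q.
  suff -> : (V *m Phi (E j) *m adj V) i i =
     (row i V *m Phi (E j) *m adj (row i V)) ord0 ord0 by [].
  by rewrite -row_mul !mxE; apply: eq_bigr => k _; rewrite !mxE.
have qRe i j : (complex.Re (q i j))%:C = q i j by rewrite RRe_real // ger0_real.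
apply: (@sum_xlnx_doubly_stochastic _ (fun i j => complex.Re (q i j))) => //.
- by move=> i j; rewrite -ler0c qRe.
- move=> i; apply: (@complexI R); rewrite rmorph_sum /=; under eq_bigr do rewrite qRe.
  by rewrite -summxE -mulmx_suml -mulmx_sumr -Psum sumE1 uniP mulmx1 V1 mxE eqxx.
- move=> j; apply: (@complexI R); rewrite rmorph_sum /=; under eq_bigr do rewrite qRe.
  rewrite -[LHS]/(\tr (V *m Phi (E j) *m adj V)) -mulmxA mxtrace_mulC -mulmxA V2 mulmx1 trP.
  have -> : E j = adj (row j U) *m row j U by [].
  rewrite mxtrace_mulC.
  have -> : row j U *m adj (row j U) = row j (U *m adj U) *m (row j 1%:M)^T.
    rewrite row_mul -mulmxA; congr (_ *m _).
    by rewrite row1 trmx_delta; apply/matrixP => x y; rewrite -colE !mxE.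
  by rewrite U1 row1 trmx_delta mul_delta_mx /mxtrace big_ord1 mxE !eqxx.
- move=> i; apply: (@complexI R); rewrite rmorph_sum /=.
  under eq_bigr do rewrite rmorphM /= qRe.
  have -> : (b i)%:C = (V *m Phi A *m adj V) i i.
    rewrite eb !mulmxA V1 mul1mx -mulmxA V1 mulmx1 !mxE eqxx.
    by rewrite mulr1n.
  rewrite eA sumE Psum mulmx_sumr mulmx_suml summxE; apply: eq_bigr => j _.
  by rewrite PZ -scalemxAr -scalemxAl mxE mulrC.
Qed.

End Entropy.

(** * Weyl operators *)

Section Characters.
Context {R : realType} {d : nat}.
Hypothesis pd : prime d.

Lemma de_moivre (t : R) k : (cos t +i* sin t) ^+ k = cos (t * k%:R) +i* sin (t * k%:R).
Proof.
elim: k => [|k IH]; first by rewrite mulr0 cos0 sin0 expr0.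
by rewrite exprS IH -natr1 mulrDr mulr1 cosD sinD; simpc; congr (_ +i* _); ring.
Qed.

Lemma chi_power (k : 'F_d) :
  chi R k = (cos (2 * pi / d%:R) +i* sin (2 * pi / d%:R)) ^+ k.
Proof. by rewrite de_moivre /chi mulrAC. Qed.

Lemma chiD (a b : 'F_d) : chi R (a + b) = chi R a * chi R b.
Proof.
have dn : d%:R != 0 :> R by rewrite pnatr_eq0 -lt0n prime_gt0.
rewrite !chi_power -exprD; set z := (X in X ^+ _).
(* Addition in ['F_d] reduces modulo a number that equals [d] only by primality, hence the separate
   [m]. Reduction is harmless because [z ^+ d = 1]. *)
have h m (k : nat) : m = d -> z ^+ (k %% m) = z ^+ k.
  by move=> ->; rewrite expr_mod // de_moivre divfK // mulr_natl cos2pi sin2pi.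
by apply: h; exact: Fp_cast.
Qed.

Lemma chi0 : chi R (0 : 'F_d) = 1.
Proof. by rewrite chi_power expr0. Qed.

Lemma conj_chi (a : 'F_d) : conjc (chi R a) = chi R (- a).
Proof.
have u : chi R a * conjc (chi R a) = 1.
  rewrite /chi; apply/eqP; rewrite eq_complex /= mulrN opprK -!expr2 cos2Dsin2 eqxx /=.
  by apply/eqP; ring.
have n0 : chi R a != 0 by apply: contra_eqN u => /eqP ->; rewrite mul0r eq_sym oner_eq0.
by apply: (mulfI n0); rewrite u -chiD subrr chi0.
Qed.

(** The real part suffices: with [t = pi k / d], [cos (2 t) = 1] forces [sin t = 0], while
    [0 < t < pi] if [0 < k < d]. *)
Lemma chi_eq1 (a : 'F_d) : chi R a = 1 -> a = 0.
Proof.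
have dn : 0 < d%:R :> R by rewrite ltr0n prime_gt0.
case=> + _; set k := nat_of_ord a => h.
have kd : (k < d)%N by have := ltn_ord a; rewrite [X in (_ < X)%N](Fp_cast pd).
apply/val_inj => /=; apply/eqP; rewrite -/k; apply: contraT; rewrite -lt0n => k0.
pose t : R := pi * k%:R / d%:R.
have e : 2 * pi * k%:R / d%:R = t *+ 2 by rewrite /t mulr2n; ring.
have : 0 < sin t.
  apply: sin_gt0_pi; rewrite /t -mulrA mulr_gt0 ?pi_gt0 ?divr_gt0 ?ltr0n ?(prime_gt0 pd) //=.
  by rewrite gtr_pMr ?pi_gt0 // ltr_pdivrMr // mul1r ltr_nat.
move=> /gt_eqF; rewrite -sqrf_eq0 sin2cos2 => /eqP.
by case; move: h; rewrite e cos_mulr2n mulr2n; set c := cos t ^+ 2 => h; lra.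
Qed.

Lemma chi_sum (I : finType) (f : I -> 'F_d) : chi R (\sum_i f i) = \prod_i chi R (f i).
Proof. exact: (big_morph _ chiD chi0). Qed.

End Characters.

Section Weyl.
Context {R : realType} {d n : nat}.
Hypothesis pd : prime d.
Hypothesis d_odd : d != 2%N.
Notation qv := (qv d n).
Notation V := (qv * qv)%type.
Notation op := (op R d n).

Definition dot (p q : qv) : 'F_d := \sum_k p k * q k.

Lemma dotC p q : dot p q = dot q p.
Proof. by apply: eq_bigr => k _; rewrite mulrC. Qed.

Lemma dotDl p p' q : dot (p + p') q = dot p q + dot p' q.
Proof. by rewrite -big_split; apply: eq_bigr => k _; rewrite ffunE mulrDl. Qed.

Lemma dotDr p q q' : dot p (q + q') = dot p q + dot p q'.
Proof. by rewrite ![dot p _]dotC dotDl. Qed.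

Lemma dotNl p q : dot (- p) q = - dot p q.
Proof. by rewrite /dot -sumrN; apply: eq_bigr => k _; rewrite ffunE mulNr. Qed.

Lemma dotNr p q : dot p (- q) = - dot p q.
Proof. by rewrite ![dot p _]dotC dotNl. Qed.

Lemma dot0l q : dot 0 q = 0.
Proof. by rewrite /dot big1 // => k _; rewrite ffunE mul0r. Qed.

Lemma dot0r p : dot p 0 = 0.
Proof. by rewrite dotC dot0l. Qed.

Definition dotE := (dotDl, dotDr, dotNl, dotNr, dot0l, dot0r).

Lemma card_qv : #|{: qv}| = (d ^ n)%N.
Proof. by rewrite card_ffun (card_Fp pd) card_ord. Qed.

Lemma dimqE : dimq d n = (d ^ n)%N.
Proof. exact: card_qv. Qed.

(** Orthogonality of characters. If [q] is nonzero, translating by some [u] with [dot u q = 1]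
    multiplies the sum by [chi 1], which is not 1. *)
Lemma sum_chi_dot (q : qv) : \sum_p chi R (dot p q) = (d ^ n)%:R * (q == 0)%:R.
Proof.
case: eqVneq => [->|q0]; rewrite ?mulr1 ?mulr0.
  by under eq_bigr do rewrite dot0r chi0; rewrite sumr_const card_qv.
have [k qk] : exists k, q k != 0.
  by apply/existsP; rewrite -negb_forall; apply: contra q0 => /forallP h;
    apply/eqP/ffunP => k; rewrite ffunE; apply/eqP.
pose u : qv := [ffun j => if j == k then (q k)^-1 else 0].
have uq : dot u q = 1.
  rewrite /dot (bigD1 k) //= big1 => [|j jk]; rewrite !ffunE ?eqxx ?(negPf jk) ?mul0r //.
  by rewrite addr0 mulVf.
apply/eqP; have : \sum_p chi R (dot p q) = chi R (1 : 'F_d) * \sum_p chi R (dot p q).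
  rewrite [LHS](reindex_inj (addIr u)) mulr_sumr; apply: eq_bigr => p _.
  by rewrite dotDl uq chiD // mulrC.
move/eqP; rewrite -subr_eq0 -{1}[\sum_p _]mul1r -mulrBl mulf_eq0 subr_eq0.
by case/orP => // /eqP/esym/(chi_eq1 pd)/eqP; rewrite oner_eq0.
Qed.

Lemma entP (A B : op) : (forall x y, ent A x y = ent B x y) -> A = B.
Proof.
by move=> h; apply/matrixP => i j; have := h (enum_val i) (enum_val j); rewrite /ent !enum_valK.
Qed.

Lemma sum_lab (f : 'I_(dimq d n) -> R[i]) : \sum_i f i = \sum_(x : qv) f (enum_rank x).
Proof. by rewrite (reindex (@enum_rank {: qv})) //; exact/onW_bij/enum_rank_bij. Qed.

Lemma ent_mul (A B : op) x y : ent (A *m B) x y = \sum_z ent A x z * ent B z y.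
Proof. by rewrite /ent mxE sum_lab. Qed.

Lemma tr_ent (A : op) : \tr A = \sum_x ent A x x.
Proof. by rewrite /mxtrace sum_lab. Qed.

Lemma ent1 (x y : qv) : ent (1%:M : op) x y = (x == y)%:R.
Proof. by rewrite /ent mxE (inj_eq enum_rank_inj). Qed.

Lemma entZ c (A : op) x y : ent (c *: A) x y = c * ent A x y.
Proof. by rewrite /ent mxE. Qed.

Lemma ent_adj (A : op) x y : ent (adj A) x y = conjc (ent A y x).
Proof. by rewrite /ent adjE. Qed.

Lemma lab_rank (x : qv) : lab (enum_rank x) = x.
Proof. exact: enum_rankK. Qed.

Lemma two_neq0 : 2%:R != 0 :> 'F_d.
Proof. by rewrite -(dvdn_pcharf (pchar_Fp pd)) dvdn_prime2. Qed.

Lemma ent_weyl p q x y :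
  ent (weyl R p q : op) x y = chi R (dot p x - 2%:R^-1 * dot p q) * (x == y + q)%:R.
Proof.
rewrite /ent mxE !lab_rank /w1 /wphase (negPf d_odd) !big_split /=; congr (_ * _).
  rewrite -!(chi_sum pd) -(chiD pd); congr chi; rewrite addrC; congr (_ + _).
  rewrite mulr_sumr -sumrN; apply: eq_bigr => k _; rewrite mulrA.
  by rewrite -!mulNr.
rewrite -natr_prod; congr _%:R.
case: eqVneq => [->|ne]; first by rewrite big1 // => k _; rewrite ffunE eqxx.
apply/eqP; rewrite prod_nat_seq_eq0; apply/hasP.
have [k hk] : exists k, x k != (y + q) k.
  by apply/existsP; rewrite -negb_forall; apply: contra ne => /forallP h;
    apply/eqP/ffunP => k; apply/eqP.
by exists k; rewrite ?mem_index_enum //=; rewrite ffunE in hk; rewrite (negPf hk).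
Qed.

End Weyl.

(** * Weyl relations and Fourier inversion for the characteristic function *)

Section WeylAlgebra.
Context {R : realType} {d n : nat}.
Hypothesis pd : prime d.
Hypothesis d_odd : d != 2%N.
Notation qv := (qv d n).
Notation V := (qv * qv)%type.
Notation op := (op R d n).
Local Notation half := ((2%:R : 'F_d)^-1).

Definition wl (x : V) : op := weyl R x.1 x.2.
Definition xi (A : op) (x : V) : R[i] := charf A x.1 x.2.
Definition symp (x y : V) : 'F_d := dot x.1 y.2 - dot y.1 x.2.

Lemma wlM x y : wl x *m wl y = chi R (half * symp x y) *: wl (x + y).
Proof.
apply: entP => a b; rewrite ent_mul entZ (ent_weyl pd d_odd).
(* A Weyl operator has one nonzero entry per row, so a single intermediate label contributes. *)
rewrite (bigD1 (a - x.2)) //= big1 ?addr0; last first.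
  move=> c hc; rewrite (ent_weyl pd d_odd); case: eqVneq => [ea|_]; last by rewrite mulr0 mul0r.
  by rewrite ea addrK eqxx in hc.
rewrite !(ent_weyl pd d_odd) subrK eqxx mulr1 !mulrA -!(chiD pd).
have -> : (a - x.2 == b + y.2) = (a == b + (x.2 + y.2)).
  by rewrite subr_eq addrA [_ + y.2 + _]addrAC.
congr (chi R _ * _); rewrite /symp !dotE /=.
by field; exact: two_neq0.
Qed.

Lemma wl0 : wl 0 = 1%:M.
Proof.
apply: entP => a b; rewrite (ent_weyl pd d_odd) ent1 !dotE mulr0 subr0 chi0 mul1r.
by rewrite addr0.
Qed.

Lemma adj_wl x : adj (wl x) = wl (- x).
Proof.
apply: entP => a b; rewrite ent_adj !(ent_weyl pd d_odd) conjcM conjc_nat (conj_chi pd).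
have -> : (a == b - x.2) = (b == a + x.2) by rewrite -subr_eq opprK eq_sym addrC eq_sym [x.2 + a]addrC eq_sym.
case: eqVneq => [->|_]; last by rewrite !mulr0.
congr (chi R _ * _); rewrite !dotE.
by field; exact: two_neq0.
Qed.

Lemma wlN x : wl x *m wl (- x) = 1%:M.
Proof.
rewrite wlM subrr wl0 /symp /= !dotE; set u := dot _ _.
by rewrite opprK addrC subrr mulr0 chi0 scale1r.
Qed.

Lemma tr_wl x : \tr (wl x) = (d ^ n)%:R * (x == 0)%:R.
Proof.
have e a : (a == a + x.2) = (0 == x.2) by rewrite -{1}[a]addr0 (inj_eq (addrI a)).
rewrite tr_ent; under eq_bigr => a _.
  rewrite (ent_weyl pd d_odd) e (chiD pd) dotC -mulrA.
  over.
rewrite -mulr_suml (sum_chi_dot pd) -mulrA; congr (_ * _).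
case: x {e} => p q /=; rewrite -[0 in RHS]/((0 : qv, 0 : qv)) xpair_eqE [0 == q]eq_sym.
case: (p =P 0) => [->|_]; rewrite ?mul0r //= mul1r dot0l mulr0 oppr0 chi0 mul1r.
by [].
Qed.

Lemma xiE A x : xi A x = \tr (A *m wl (- x)).
Proof. by []. Qed.

(** Up to a phase, [xi] is a Fourier transform along the shifted diagonal of entries
    [(a, a - x.2)]. *)
Lemma xi_ent A x :
  xi A x = chi R (half * dot x.1 x.2) *
           \sum_a ent A a (a - x.2) * chi R (dot a (- x.1)).
Proof.
rewrite xiE tr_ent mulr_sumr; apply: eq_bigr => a _.
rewrite ent_mul (bigD1 (a - x.2)) //= big1 ?addr0; last first.
  move=> c hc; rewrite (ent_weyl pd d_odd) -[c == _]subr_eq0 /= opprB addrA.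
  by rewrite -subr_eq0 in hc; rewrite opprB addrA in hc; rewrite (negPf hc) !mulr0.
rewrite (ent_weyl pd d_odd) eqxx mulr1 mulrCA -(chiD pd); congr (_ * chi R _).
rewrite /= !dotE [dot a _]dotC.
by field; exact: two_neq0.
Qed.

(** Fourier inversion: summing over [p] at fixed shift [a - b] recovers the entry [(a, b)]. Operator
    identities can thus be checked on characteristic functions. *)
Lemma xi_inj A B : xi A =1 xi B -> A = B.
Proof.
move=> h; apply: entP => a b.
have key C : \sum_p chi R (dot p a) * chi R (- (half * dot p (a - b))) * xi C (p, a - b)
    = (d ^ n)%:R * ent C a b.
  under eq_bigr => p _.
    rewrite xi_ent /= -mulrA [X in _ * X]mulrA -(chiD pd) addNr chi0 mul1r mulr_sumr.
    over.
  rewrite exchange_big /= (bigD1 a) //= [X in _ + X]big1 ?addr0 => [|c ca].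
    under eq_bigr do rewrite mulrCA -(chiD pd) dotC dotNr subrr chi0 mulr1.
    by rewrite sumr_const card_qv // opprB addrCA subrr addr0 mulr_natl.
  under eq_bigr do rewrite mulrCA -(chiD pd) [dot c _]dotC dotNl -dotNr -dotDr.
  by rewrite -mulr_sumr sum_chi_dot // subr_eq0 eq_sym (negPf ca) !mulr0.
have d0 : (d ^ n)%:R != 0 :> R[i] by rewrite pnatr_eq0 expn_eq0 negb_and -lt0n prime_gt0.
by apply: (mulfI d0); rewrite -!key; apply: eq_bigr => p _; rewrite h.
Qed.

Lemma xi_wl x y : xi (wl x) y = (d ^ n)%:R * (x == y)%:R.
Proof.
rewrite xiE wlM mxtraceZ tr_wl subr_eq0; case: eqVneq => [->|_]; last by rewrite !mulr0.
by rewrite /symp /= !dotE opprK addrC subrr mulr0 chi0 mul1r.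
Qed.

Lemma xiZ c A x : xi (c *: A) x = c * xi A x.
Proof. by rewrite !xiE -scalemxAl mxtraceZ. Qed.

Lemma xi_sum (I : finType) (P : pred I) (F : I -> op) x :
  xi (\sum_(i | P i) F i) x = \sum_(i | P i) xi (F i) x.
Proof. by rewrite xiE mulmx_suml raddf_sum. Qed.

(** The operator selected by [xget] is pinned down by [xi_inj], so exhibiting one candidate computes
    [meanState]. *)
Lemma meanState_unique (A tau : op) :
  (forall x, xi tau x = if `|xi A x| == 1 then xi A x else 0) -> meanState A = tau.
Proof.
move=> h; apply: xget_unique => [p q|t ht]; first exact: (h (p, q)).
by apply: xi_inj => x; rewrite h; apply: ht.
Qed.

End WeylAlgebra.

(** * Quantum convolution *)

Lemma det_mx22 (A : comNzRingType) (M : 'M[A]_2) :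
  \det M = M ord0 ord0 * M ord_max ord_max - M ord0 ord_max * M ord_max ord0.
Proof.
rewrite (expand_det_row M ord0) !big_ord_recl big_ord0 addr0 /cofactor !det_mx11 !mxE /=.
rewrite !expr0 !expr1 mul1r mulN1r mulrN.
by congr (M _ _ * M _ _ - M _ _ * M _ _); apply/val_inj.
Qed.

Section Cramer.
Context {F : fieldType}.
Variables p q r s : F.
Hypothesis D : p * s - q * r != 0.
Local Notation N := ((p * s - q * r)^-1).

Lemma cramerK a b :
  (N * s * (p * a + r * b) - N * r * (q * a + s * b) = a) *
  (- (N * q * (p * a + r * b)) + N * p * (q * a + s * b) = b).
Proof. by split; field. Qed.

Lemma cramerVK a b :
  (p * (N * s * a - N * r * b) + r * (- (N * q * a) + N * p * b) = a) *
  (q * (N * s * a - N * r * b) + s * (- (N * q * a) + N * p * b) = b).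
Proof. by split; field. Qed.

Lemma cramer_det u : N * s * (p * u) + - (N * r) * (q * u) = u.
Proof. by field. Qed.

(** In [xi_boxprod], [v] comes from the register traced out: its coefficients cancel, and those of
    [u] add up to [- N (p s - q r) = -1]. *)
Lemma cramer_dual u v :
  - u = - (p * (N * s * u)) - r * (N * s * v) +
        (- (q * (- (N * r) * u)) - s * (- (N * r) * v)).
Proof. by field. Qed.

End Cramer.

Section Convolution.
Context {R : realType} {d n : nat}.
Hypothesis pd : prime d.
Hypothesis d_odd : d != 2%N.
Notation qv := (qv d n).
Notation V := (qv * qv)%type.
Notation op := (op R d n).

Definition sc (c : 'F_d) (v : qv) : qv := [ffun k => c * v k].

Lemma scK c : c != 0 -> cancel (sc c) (sc c^-1).
Proof. by move=> c0 v; apply/ffunP => k; rewrite !ffunE mulKf. Qed.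

Lemma scM a b v : sc a (sc b v) = sc (a * b) v.
Proof. by apply/ffunP => k; rewrite !ffunE mulrA. Qed.

Lemma scB c u v : sc c (u - v) = sc c u - sc c v.
Proof. by apply/ffunP => k; rewrite !ffunE mulrBr. Qed.

Lemma sc_eq0 c v : c != 0 -> (sc c v == 0) = (v == 0).
Proof.
move=> c0; apply/eqP/eqP => [e|->]; last by apply/ffunP => k; rewrite !ffunE mulr0.
by rewrite -(scK c0 v) e; apply/ffunP => k; rewrite !ffunE mulr0.
Qed.

Lemma dot_scl c (u v : qv) : dot (sc c u) v = c * dot u v.
Proof. by rewrite /dot mulr_sumr; apply: eq_bigr => k _; rewrite ffunE mulrA. Qed.

Lemma dot_scr c (u v : qv) : dot u (sc c v) = c * dot u v.
Proof. by rewrite dotC dot_scl dotC. Qed.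

Variable G : 'M['F_d]_2.
Hypothesis detG : \det G != 0.
Local Notation g00 := (G ord0 ord0).
Local Notation g01 := (G ord0 ord_max).
Local Notation g10 := (G ord_max ord0).
Local Notation g11 := (G ord_max ord_max).
Local Notation N := ((\det G)^-1).

Lemma detE : \det G = g00 * g11 - g01 * g10.
Proof. exact: det_mx22. Qed.

(** The action of the transpose of [G] on pairs of registers, which is the inverse of [keyperm]. *)
Definition keyinv (ab : V) : V := (sc g00 ab.1 + sc g10 ab.2, sc g01 ab.1 + sc g11 ab.2).

Let D : g00 * g11 - g01 * g10 != 0. Proof. by rewrite -detE. Qed.

Lemma keyinvK : cancel keyinv (keyperm G).
Proof.
move=> [a b]; rewrite /keyperm detE; congr pair; apply/ffunP => k; rewrite !ffunE /= ?ffunE.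
  exact: (cramerK D _ _).1.
exact: (cramerK D _ _).2.
Qed.

Lemma keypermK : cancel (keyperm G) keyinv.
Proof.
move=> [a b]; rewrite /keyinv /keyperm detE; congr pair; apply/ffunP => k; rewrite !ffunE /= ?ffunE.
  exact: (cramerVK D _ _).1.
exact: (cramerVK D _ _).2.
Qed.

(** [U] is a permutation matrix, so each inner sum reduces to the unique preimage under
    [keyperm]. *)
Lemma ent_boxprod (rho sigma : op) a a' :
  ent (boxprod G rho sigma) a a' = \sum_b
    ent rho (keyinv (a, b)).1 (keyinv (a', b)).1 * ent sigma (keyinv (a, b)).2 (keyinv (a', b)).2.
Proof.
rewrite {1}/ent mxE !lab_rank; apply: eq_bigr => b _.
have e x (z : V) : (x == keyperm G z) = (z == keyinv x).
  by apply/eqP/eqP => ->; rewrite ?keypermK ?keyinvK.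
rewrite (bigD1 (keyinv (a, b))) //= [X in _ + X]big1 ?addr0 => [|z hz]; last first.
  by apply: big1 => y _; rewrite /keyU e (negPf hz) !mul0r.
rewrite (bigD1 (keyinv (a', b))) //= [X in _ + X]big1 ?addr0 => [|z hz]; last first.
  by rewrite /keyU [(a', b) == _]e (negPf hz) conjc_nat mulr0.
by rewrite /keyU !e !eqxx conjc_nat mul1r mulr1.
Qed.

Definition L1 (x : V) : V := (sc (N * g11) x.1, sc g00 x.2).
Definition L2 (x : V) : V := (sc (- (N * g10)) x.1, sc g01 x.2).

(** The convolution theorem. Reindexing the double sum on the right by [keyinv] matches it with the
    output entries; the maps [L1] and [L2] make the phases agree. *)
Lemma xi_boxprod (rho sigma : op) x :
  xi (boxprod G rho sigma) x = xi rho (L1 x) * xi sigma (L2 x).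
Proof.
rewrite !(xi_ent pd d_odd) mulrACA -(chiD pd); congr (chi R _ * _).
  rewrite /= !dot_scl !dot_scr detE -mulrDr; congr (_ * _).
  by rewrite cramer_det.
under eq_bigr do rewrite ent_boxprod mulr_suml.
rewrite big_distrlr /= pair_big /= [RHS]pair_big /=.
rewrite [RHS](reindex keyinv) /=; last by apply/onW_bij; exists (keyperm G); [exact: keyinvK | exact: keypermK].
apply: eq_bigr => -[a b] _ /=.
rewrite mulrACA -(chiD pd) !scB -!addrA ![- _ + _]addrC; congr (_ * chi R _).
rewrite !dotDl !dotNr !dot_scl !dot_scr detE.
exact: (cramer_dual D).
Qed.

Lemma xi0 (A : op) : xi A 0 = \tr A.
Proof. by rewrite xiE oppr0 (wl0 pd d_odd) mulmx1. Qed.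

Lemma xi1 x : xi (1%:M : op) x = (d ^ n)%:R * (x == 0)%:R.
Proof. by rewrite -(wl0 pd d_odd) (xi_wl pd d_odd) eq_sym. Qed.

Lemma xiD (A B : op) x : xi (A + B) x = xi A x + xi B x.
Proof. by rewrite !xiE mulmxDl mxtraceD. Qed.

Lemma boxprod_linear_r (rho : op) : linear (fun sigma : op => boxprod G rho sigma).
Proof.
move=> c A B; apply: (xi_inj pd d_odd) => x.
by rewrite xiD xiZ !xi_boxprod xiD xiZ mulrDr mulrCA.
Qed.

Lemma sc0 c : sc c 0 = 0.
Proof. by apply/ffunP => k; rewrite !ffunE mulr0. Qed.

Lemma tr_boxprod (rho sigma : op) : \tr (boxprod G rho sigma) = \tr rho * \tr sigma.
Proof. by rewrite -!xi0 xi_boxprod /L1 /L2 /= !sc0. Qed.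

Hypothesis posG : positiveG G.

Lemma N_neq0 : N != 0. Proof. by rewrite invr_eq0. Qed.

Lemma L1_eq0 x : (L1 x == 0) = (x == 0).
Proof. by case: x => p q; rewrite /L1 !xpair_eqE !sc_eq0 ?mulf_neq0 ?N_neq0 ?posG. Qed.

Lemma L2_eq0 x : (L2 x == 0) = (x == 0).
Proof. by case: x => p q; rewrite /L2 !xpair_eqE !sc_eq0 ?oppr_eq0 ?mulf_neq0 ?N_neq0 ?posG. Qed.

(** Positivity of [G] makes [L2] vanish only at 0, so the product of characteristic functions is
    supported at 0 like that of the identity. *)
Lemma boxprod1r (rho : op) : boxprod G rho 1%:M = (\tr rho) *: 1%:M.
Proof.
apply: (xi_inj pd d_odd) => x; rewrite xi_boxprod xiZ !xi1 L2_eq0.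
by case: eqVneq => [->|_]; rewrite ?mulr0 // -xi0 /L1 /= !sc0.
Qed.

Lemma psd_boxprod (rho sigma : op) : psd rho -> psd sigma -> psd (boxprod G rho sigma).
Proof.
move=> /psd_factor [B ->] /psd_factor [C ->].
(* After factoring both inputs, the output is a sum of rank-one positive terms, indexed by the
   traced label [b] and the rows [k], [l] of the factors. *)
pose W b k l : 'rV[R[i]]_(dimq d n) := \row_a (B k (enum_rank (keyinv (lab a, b)).1) *
  C l (enum_rank (keyinv (lab a, b)).2)).
suff -> : boxprod G (adj B *m B) (adj C *m C) = \sum_b \sum_k \sum_l adj (W b k l) *m W b k l.
  by do 3 (apply: psd_sum => ?); apply: psd_adjM.
apply: entP => a a'; rewrite ent_boxprod [RHS]summxE; apply: eq_bigr => b _.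
rewrite summxE /ent ![(adj _ *m _) _ _]mxE big_distrlr /=; apply: eq_bigr => k _.
rewrite summxE; apply: eq_bigr => l _.
by rewrite !mxE big_ord1 !mxE !lab_rank conjcM mulrACA.
Qed.

Lemma vN_boxprod (rho sigma : op) : psd rho -> \tr rho = 1 -> psd sigma ->
  vN sigma <= vN (boxprod G rho sigma).
Proof.
move=> prho trho; apply: (vN_unital (boxprod_linear_r rho)).
- by move=> B; apply: psd_boxprod.
- by rewrite boxprod1r trho scale1r.
- by move=> B; rewrite tr_boxprod trho mul1r.
Qed.

End Convolution.

(** * Stabilizer states and the mean state *)

Section UnitaryEigen.
Context {R : realType}.

Lemma mulc_conj (z : R[i]) : `|z| = 1 -> z * conjc z = 1.
Proof. by move=> h; rewrite -sqr_normc h expr1n. Qed.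

Lemma mxtraceB m (A B : 'M[R[i]]_m) : \tr (A - B) = \tr A - \tr B.
Proof. exact: raddfB. Qed.

Lemma tr_adj m (A : 'M[R[i]]_m) : \tr (adj A) = conjc (\tr A).
Proof. by rewrite /mxtrace (rmorph_sum (@conjc R)) /=; apply: eq_bigr => i _; rewrite adjE. Qed.

(* Equality case of Cauchy-Schwarz: the squared Hilbert-Schmidt norm of
   [(W - z) sqrt(A)] is [1 - |z|^2 - |z|^2 + |z|^2]. *)
Lemma unitary_eigen m (A W : 'M[R[i]]_m) (z : R[i]) :
  psd A -> \tr A = 1 -> adj W *m W = 1%:M -> \tr (W *m A) = z -> `|z| = 1 ->
  W *m A = z *: A.
Proof.
move=> psdA trA WW trWA z1; have [C eC] := psd_factor psdA; have [hA _] := psdA.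
pose M := (W - z%:M) *m adj C.
have eM : adj M *m M = C *m (1%:M - z *: adj W - conjc z *: (W - z%:M)) *m adj C.
  rewrite /M adjM adjK mulmxA -[C *m _ *m (W - _)]mulmxA; congr (C *m _ *m _).
  rewrite adjB -!(scalemx1 _ z) adj_scale adj_id mulmxBl mulmxBr WW -scalemxAr mulmx1.
  by rewrite -scalemxAl mul1mx.
have M0 : M = 0.
  apply: tr_adjM_eq0; rewrite eM -mulmxA mxtrace_mulC -mulmxA -eC.
  rewrite mulmxBl mxtraceB mulmxBl mxtraceB mul1mx -!scalemxAl !mxtraceZ mulmxBl mxtraceB.
  have -> : \tr (adj W *m A) = conjc z by rewrite -trWA -tr_adj adjM hA mxtrace_mulC.
  by rewrite mul_scalar_mx mxtraceZ trA trWA mulr1 mulc_conj // subrr subrr mulr0 subrr.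
apply/eqP; rewrite -subr_eq0 -mul_scalar_mx -mulmxBl eC mulmxA -/M M0.
by rewrite mul0mx.
Qed.

End UnitaryEigen.

Section Stabilizer.
Context {R : realType} {d n : nat}.
Hypothesis pd : prime d.
Hypothesis d_odd : d != 2%N.
Notation qv := (qv d n).
Notation V := (qv * qv)%type.
Notation op := (op R d n).

Definition isotropic (S : {set V}) : Prop :=
  [/\ 0 \in S, forall x y, x \in S -> y \in S -> x - y \in S &
      forall x y, x \in S -> y \in S -> symp x y = 0].

Definition unitary_char (S : {set V}) (f : V -> R[i]) : Prop :=
  [/\ f 0 = 1, forall x y, x \in S -> y \in S -> f (x + y) = f x * f y &
      forall x, x \in S -> f (- x) = conjc (f x)].

(** The normalization makes [xi] equal to [f] on [S] and 0 elsewhere; for a character of an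
    isotropic subgroup this is a stabilizer state. *)
Definition stab (S : {set V}) (f : V -> R[i]) : op :=
  (d ^ n)%:R^-1 *: \sum_(x in S) f x *: wl x.

(** By antisymmetry of [symp] the two half-phases differ by the factor [chi (symp x y)], so
    commuting Weyl operators have vanishing symplectic product. *)
Lemma chi_symp_inj (x y : V) :
  chi R (2%:R^-1 * symp x y) = chi R (2%:R^-1 * symp y x) -> symp x y = 0.
Proof.
move=> e; have : chi R (2%:R^-1 * symp x y - 2%:R^-1 * symp y x) = 1.
  by rewrite (chiD pd) e -(chiD pd) subrr chi0.
by move/(chi_eq1 pd) => <-; rewrite /symp; field; exact: two_neq0.
Qed.

Lemma dn_gt0 : 0 < (d ^ n)%:R :> R.
Proof. by rewrite ltr0n expn_gt0 prime_gt0. Qed.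

Lemma dn_neq0 : (d ^ n)%:R != 0 :> R[i].
Proof. by rewrite pnatr_eq0 expn_eq0 negb_and -lt0n prime_gt0. Qed.

Lemma xi_stab S f x : xi (stab S f) x = if x \in S then f x else 0.
Proof.
rewrite /stab xiZ xi_sum; under eq_bigr do rewrite xiZ (xi_wl pd d_odd).
case: ifPn => [xS|xS].
  rewrite (bigD1 x) //= eqxx mulr1 big1 ?addr0 => [|y /andP[_ /negPf ->]]; last by rewrite !mulr0.
  by rewrite mulrCA mulVf ?mulr1 ?dn_neq0.
rewrite big1 ?mulr0 // => y yS; case: eqVneq => [e|_]; rewrite ?mulr0 //.
by rewrite -e yS in xS.
Qed.

Section OnSubgroup.
Variables (S : {set V}) (f : V -> R[i]).
Hypothesis isoS : isotropic S.
Hypothesis chf : unitary_char S f.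

Lemma subgroupN x : x \in S -> - x \in S.
Proof. by move=> xS; have [S0 SB _] := isoS; rewrite -sub0r SB. Qed.

Lemma subgroupDr x y : x \in S -> (x + y \in S) = (y \in S).
Proof.
move=> xS; have [S0 SB _] := isoS; apply/idP/idP => h.
  by rewrite -[y](addrK x) [y + x]addrC SB.
by rewrite -[y]opprK SB // subgroupN.
Qed.

Lemma wl_isotropic x y : x \in S -> y \in S -> wl x *m wl y = wl (x + y) :> op.
Proof. by move=> xS yS; have [_ _ h] := isoS; rewrite (wlM pd d_odd) h // mulr0 chi0 scale1r. Qed.

(** Translation by [x] permutes [S]; multiplicativity of [f] pulls out the scalar [f (- x)]. *)
Lemma wl_stab x : x \in S -> wl x *m stab S f = f (- x) *: stab S f.
Proof.
move=> xS; have [f0 fD fN] := chf.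
rewrite /stab -scalemxAr [RHS]scalerA [f _ * _]mulrC -[RHS]scalerA; congr (_ *: _).
rewrite mulmx_sumr [in RHS](reindex_inj (addrI x)) /= scaler_sumr.
rewrite [in RHS](eq_bigl (mem S)) => [|y]; last exact: subgroupDr.
apply: eq_bigr => y yS; rewrite -scalemxAr wl_isotropic // scalerA.
by rewrite -fD ?subgroupN ?subgroupDr // addKr.
Qed.

Lemma stab_wl x : x \in S -> stab S f *m wl x = f (- x) *: stab S f.
Proof.
move=> xS; rewrite -wl_stab // /stab -scalemxAr -scalemxAl mulmx_suml mulmx_sumr; congr (_ *: _).
by apply: eq_bigr => y yS; rewrite -scalemxAl -scalemxAr !wl_isotropic // addrC.
Qed.

(** Each of the [#|S|] terms [f x *: wl x] fixes the state, because [f x * f (- x) = 1]. The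
    spectrum is therefore flat, which gives positivity and the entropy. *)
Lemma stabM : stab S f *m stab S f = (#|S|%:R / (d ^ n)%:R)%:C *: stab S f.
Proof.
have [f0 fD fN] := chf.
have e : \sum_(x in S) (f x *: wl x) *m stab S f = stab S f *+ #|S|.
  rewrite -sumr_const; apply: eq_bigr => x xS.
  by rewrite -scalemxAl wl_stab // scalerA -fD ?subgroupN // subrr f0 scale1r.
rewrite {1}/stab -scalemxAl mulmx_suml e -[stab S f *+ _]scaler_nat scalerA.
by congr (_ *: _); rewrite rmorphM fmorphV !rmorph_nat mulrC.
Qed.

Lemma adj_stab : adj (stab S f) = stab S f.
Proof.
have [f0 fD fN] := chf.
rewrite /stab adj_scale adj_sum conjc_inv conjc_nat; congr (_ *: _).
rewrite [in RHS](reindex_inj (@oppr_inj V)) /=; apply: eq_big => x.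
  by apply/idP/idP => /subgroupN; rewrite ?opprK.
by move=> xS; rewrite adj_scale (adj_wl pd d_odd) fN.
Qed.

Lemma cardS_gt0 : 0 < #|S|%:R :> R.
Proof. by have [S0 _ _] := isoS; rewrite ltr0n; apply/card_gt0P; exists 0. Qed.

Lemma psd_stab : psd (stab S f).
Proof.
have c0 : 0 < #|S|%:R / (d ^ n)%:R :> R by rewrite divr_gt0 ?cardS_gt0 ?dn_gt0.
have -> : stab S f = ((#|S|%:R / (d ^ n)%:R)^-1)%:C *: (adj (stab S f) *m stab S f).
  by rewrite adj_stab stabM scalerA -rmorphM mulVf ?gt_eqF // scale1r.
by apply: psdZ; [rewrite invr_ge0 ltW | exact: psd_adjM].
Qed.

Lemma tr_stab : \tr (stab S f) = 1.
Proof. by have [S0 _ _] := isoS; have [f0 _ _] := chf; rewrite -(xi0 pd d_odd) xi_stab S0. Qed.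

Lemma vN_stab : vN (stab S f) = n%:R * ln d%:R - ln #|S|%:R.
Proof.
rewrite (vN_flat psd_stab tr_stab _ stabM) ?divr_gt0 ?cardS_gt0 ?dn_gt0 //.
rewrite ln_div ?posrE ?cardS_gt0 ?dn_gt0 // opprB; congr (_ - _).
by rewrite natrX lnXn ?ltr0n ?prime_gt0 // mulr_natl.
Qed.

End OnSubgroup.

Section MeanState.
Variable sigma : op.
Hypothesis psd_sigma : psd sigma.
Hypothesis tr_sigma : \tr sigma = 1.

Definition unimod : {set V} := [set x | `|xi sigma x| == 1].

Lemma xiN x : xi sigma (- x) = conjc (xi sigma x).
Proof.
have [hs _] := psd_sigma.
by rewrite !xiE -tr_adj adjM hs (adj_wl pd d_odd) mxtrace_mulC.
Qed.

(** A characteristic value of modulus 1 is an extremal expectation of a unitary, so [unitary_eigen]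
    applies. The group structure of [unimod] follows from it. *)
Lemma wl_unimod x : x \in unimod -> wl (- x) *m sigma = xi sigma x *: sigma.
Proof.
rewrite inE => /eqP h; apply: unitary_eigen => //; last by rewrite mxtrace_mulC.
by rewrite (adj_wl pd d_odd) opprK; exact: wlN.
Qed.

Lemma sigma_neq0 : sigma != 0.
Proof.
by apply/eqP => e; have /eqP := tr_sigma; rewrite e mxtrace0 eq_sym oner_eq0.
Qed.

Lemma unimodN x : x \in unimod -> - x \in unimod.
Proof. by rewrite !inE xiN normcJ. Qed.

Lemma isotropic_unimod_symp x y : x \in unimod -> y \in unimod -> symp x y = 0.
Proof.
move=> xS yS.
have nz u : u \in unimod -> xi sigma u != 0.
  by rewrite inE -normr_eq0 => /eqP ->; rewrite oner_eq0.
have e1 : wl (- x) *m (wl (- y) *m sigma) = wl (- y) *m (wl (- x) *m sigma).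
  by rewrite (wl_unimod xS) (wl_unimod yS) -!scalemxAr (wl_unimod xS) (wl_unimod yS) !scalerA mulrC.
move: e1; rewrite !mulmxA !(wlM pd d_odd) [- y - x]addrC -!scalemxAl.
(* Weyl operators are invertible and [sigma] is nonzero, so the two commutation phases may be
   compared. *)
have e2 : wl (- x - y) *m sigma != 0.
  apply/eqP => e; have := congr1 (mulmx (wl (- (- x - y)))) e.
  rewrite mulmxA mulmx0 -{2}[- x - y]opprK (wlN pd d_odd) mul1mx => /eqP.
  by rewrite (negPf sigma_neq0).
move/eqP; rewrite -subr_eq0 -scalerBl scaler_eq0 (negPf e2) orbF subr_eq0 => /eqP e3.
have := chi_symp_inj e3; rewrite /symp /= !dotNl !dotNr !opprK.
exact.
Qed.

Lemma xi_unimodD x y : x \in unimod -> y \in unimod ->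
  xi sigma (x + y) = xi sigma x * xi sigma y.
Proof.
move=> xS yS.
have e : wl (- x) *m wl (- y) = wl (- (x + y)) :> op.
  by rewrite (wlM pd d_odd) isotropic_unimod_symp ?unimodN // mulr0 chi0 scale1r opprD.
rewrite xiE -e mxtrace_mulC -mulmxA wl_unimod // -scalemxAr wl_unimod //.
by rewrite scalerA mxtraceZ tr_sigma mulr1 mulrC.
Qed.

Lemma isotropic_unimod : isotropic unimod.
Proof.
split=> [|x y xS yS|]; last exact: isotropic_unimod_symp.
  by rewrite inE (xi0 pd d_odd) tr_sigma normr1.
rewrite inE xi_unimodD ?unimodN // normrM xiN normcJ.
by move: xS yS; rewrite !inE => /eqP -> /eqP ->; rewrite mulr1.
Qed.

Lemma unitary_char_unimod : unitary_char unimod (xi sigma).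
Proof.
by split=> [|x y|x _]; [rewrite (xi0 pd d_odd) | exact: xi_unimodD | exact: xiN].
Qed.

Lemma meanStateE : meanState sigma = stab unimod (xi sigma).
Proof. by apply: (meanState_unique pd d_odd) => x; rewrite xi_stab inE. Qed.

End MeanState.

Lemma meanState_stab S f : isotropic S -> unitary_char S f ->
  meanState (stab S f) = stab S f.
Proof.
move=> isoS chf; apply: (meanState_unique pd d_odd) => x; rewrite xi_stab.
case: ifPn => xS; last by rewrite normr0 eq_sym oner_eq0.
have [f0 fD fN] := chf.
have := fD x (- x) xS (subgroupN isoS xS); rewrite subrr f0 fN // -sqr_normc => /esym/eqP.
by rewrite sqrp_eq1 // => ->.
Qed.

End Stabilizer.

(** * Holevo capacity *)

Section Ensemble.
Context {R : realType} {d n : nat}.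
Hypothesis pd : prime d.
Hypothesis d_odd : d != 2%N.
Notation qv := (qv d n).
Notation V := (qv * qv)%type.
Notation op := (op R d n).

(** Common form of [L1] and [L2]. It multiplies [symp] by [a * b], so for nonzero factors preimages
    of isotropic subgroups are isotropic. *)
Definition scale2 (a b : 'F_d) (x : V) : V := (sc a x.1, sc b x.2).

Lemma scale2D a b x y : scale2 a b (x + y) = scale2 a b x + scale2 a b y.
Proof. by congr pair; apply/ffunP => k; rewrite !ffunE mulrDr. Qed.

Lemma scale2N a b x : scale2 a b (- x) = - scale2 a b x.
Proof. by congr pair; apply/ffunP => k; rewrite !ffunE mulrN. Qed.

Lemma scale20 a b : scale2 a b 0 = 0.
Proof. by rewrite /scale2 /= !sc0. Qed.

Lemma symp_scale2 a b x y : symp (scale2 a b x) (scale2 a b y) = a * b * symp x y.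
Proof. by rewrite /symp /= !dot_scl !dot_scr; ring. Qed.

Lemma scale2_bij a b : a != 0 -> b != 0 -> bijective (scale2 a b).
Proof.
move=> a0 b0; exists (scale2 a^-1 b^-1) => -[p q]; rewrite /scale2 /= ?(scK a0) ?(scK b0) //.
by rewrite !scM !mulfV //; congr pair; apply/ffunP => k; rewrite ffunE mul1r.
Qed.

Lemma isotropic_scale2 a b (S : {set V}) : a != 0 -> b != 0 ->
  isotropic S -> isotropic (scale2 a b @^-1: S).
Proof.
move=> a0 b0 [S0 SB Ss]; split=> [|x y|x y]; rewrite !inE ?scale20 // => xS yS.
  by rewrite scale2D scale2N SB.
by apply: (mulfI (mulf_neq0 a0 b0)); rewrite -symp_scale2 Ss // mulr0.
Qed.

Lemma card_scale2 a b (S : {set V}) : a != 0 -> b != 0 -> #|scale2 a b @^-1: S| = #|S|.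
Proof. by move=> a0 b0; apply: on_card_preimset; apply: onW_bij; exact: scale2_bij. Qed.

(** The pairing is the ordinary dot product, not the symplectic form; it gives additive characters
    of the whole phase space. *)
Definition lchar (x y : V) : R[i] := chi R (dot x.1 y.1 + dot x.2 y.2).

Lemma unitary_lchar S x : unitary_char S (lchar x).
Proof.
split=> [|y z _ _|y _]; rewrite /lchar.
- by rewrite !dot0r addr0 chi0.
- by rewrite -(chiD pd) /= !dotDr addrACA.
- by rewrite (conj_chi pd) /= !dotNr opprD.
Qed.

Lemma card_V : #|{: V}| = (d ^ n * d ^ n)%N.
Proof. by rewrite card_prod !card_qv. Qed.

Lemma cardV_neq0 : #|{: V}|%:R != 0 :> R[i].
Proof. by rewrite card_V natrM mulf_neq0 // (dn_neq0 pd). Qed.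

Lemma sum_lchar y : \sum_x lchar x y = #|{: V}|%:R * (y == 0)%:R.
Proof.
rewrite /lchar -(pair_bigA _ (fun p q => chi R (dot p y.1 + dot q y.2))) /=.
under eq_bigr do under eq_bigr do rewrite (chiD pd).
rewrite -big_distrlr /= !(sum_chi_dot pd) card_V natrM mulrACA; congr (_ * _).
by case: y => p q; rewrite -[0 in RHS]/((0 : qv, 0 : qv)) xpair_eqE -natrM mulnb.
Qed.

(** The maximally mixed state, written as a stabilizer state so that [vN_stab] yields its
    entropy. *)
Definition flat : op := stab [set (0 : V)] (fun=> 1).

Lemma isotropic0 : isotropic [set (0 : V)].
Proof.
split=> [|x y|x y]; rewrite ?inE // => /eqP -> /eqP ->; first by rewrite subrr.
by rewrite /symp /= !dotE subrr.
Qed.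

Lemma vN_flat_state : vN flat = n%:R * ln d%:R.
Proof.
rewrite (vN_stab pd d_odd isotropic0) ?cards1 ?ln1 ?subr0 //.
by split=> // *; rewrite ?mulr1 ?conjc1.
Qed.

Lemma xi_flat y : xi flat y = (y == 0)%:R.
Proof. by rewrite (xi_stab pd d_odd) inE; case: eqP. Qed.

Variable G : 'M['F_d]_2.
Hypothesis detG : \det G != 0.
Hypothesis posG : positiveG G.
Variable sigma : op.
Hypothesis psd_sigma : psd sigma.
Hypothesis tr_sigma : \tr sigma = 1.

Local Notation S := (unimod sigma).
Local Notation a1 := ((\det G)^-1 * G ord_max ord_max).
Local Notation b1 := (G ord0 ord0).
Local Notation a2 := (- ((\det G)^-1 * G ord_max ord0)).
Local Notation b2 := (G ord0 ord_max).
(** The ratios are those of the coefficients of [L2] to those of [L1]: hence [L1 y] lies in [S1]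
    exactly when [L2 y] lies in [S], and both factors of [xi_boxprod] have the same support. *)
Local Notation S1 := (scale2 (a2 / a1) (b2 / b1) @^-1: S).
Local Notation S2 := (scale2 a2 b2 @^-1: S).

Let a1_neq0 : a1 != 0. Proof. by rewrite mulf_neq0 ?invr_eq0. Qed.
Let a2_neq0 : a2 != 0. Proof. by rewrite oppr_eq0 mulf_neq0 ?invr_eq0. Qed.

Definition probe (x : V) : op := stab S1 (lchar x).

Lemma isotropic_S1 : isotropic S1.
Proof.
apply: isotropic_scale2; last exact: isotropic_unimod.
all: by rewrite mulf_neq0 ?invr_eq0.
Qed.

Lemma probe_state x : is_state (probe x).
Proof.
have [h1 h2] := psd_stab pd d_odd isotropic_S1 (unitary_lchar _ x).
by split=> //; exact: (tr_stab pd d_odd isotropic_S1 (unitary_lchar _ x)).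
Qed.

Lemma L1_S1 y : (L1 G y \in S1) = (y \in S2).
Proof.
rewrite !inE; congr (`|xi sigma _| == 1).
by rewrite /scale2 /L1 /= !scM !divfK.
Qed.

Definition out_char x y := lchar x (L1 G y) * xi sigma (L2 G y).

Lemma boxprod_probe x : boxprod G (probe x) sigma = stab S2 (out_char x).
Proof.
apply: (xi_inj pd d_odd) => y; rewrite (xi_boxprod pd d_odd detG) !(xi_stab pd d_odd) L1_S1.
by case: ifP; rewrite ?mul0r.
Qed.

Lemma unitary_out_char x : unitary_char S2 (out_char x).
Proof.
have [l0 lD lN] := unitary_lchar [set: V]%SET x.
have [s0 sD sN] := unitary_char_unimod pd d_odd psd_sigma tr_sigma.
have e1 y : L1 G y = scale2 a1 b1 y by [].
have e2 y : L2 G y = scale2 a2 b2 y by [].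
split=> [|y z|y].
- by rewrite /out_char e1 e2 !scale20 l0 s0 mul1r.
- rewrite [y \in _]inE [z \in _]inE => yS zS; rewrite /out_char !e1 !e2 !scale2D.
  by rewrite lD ?inE // sD // mulrACA.
- by rewrite inE => yS; rewrite /out_char !e1 !e2 !scale2N lN ?inE // sN // conjcM.
Qed.

Lemma vN_boxprod_probe x :
  vN (boxprod G (probe x) sigma) = n%:R * ln d%:R - ln #|S|%:R.
Proof.
rewrite boxprod_probe (vN_stab pd d_odd _ (unitary_out_char x)) ?card_scale2 //.
by apply: isotropic_scale2 => //; exact: isotropic_unimod.
Qed.

(** Only the character depends on [x]; averaging it kills every [y] with [L1 G y] nonzero, that is,
    every nonzero [y]. *)
Lemma avg_boxprod_probe :
  \sum_x ((#|{: V}|%:R : R)^-1)%:C *: boxprod G (probe x) sigma = flat.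
Proof.
apply: (xi_inj pd d_odd) => y; rewrite xi_sum xi_flat.
under eq_bigr do rewrite xiZ (xi_boxprod pd d_odd detG) (xi_stab pd d_odd) L1_S1.
rewrite -mulr_sumr -mulr_suml fmorphV rmorph_nat.
case yS: (y \in S2); last first.
  rewrite big1 // mul0r mulr0; case: eqP => // y0; move: yS.
  by rewrite y0 inE scale20 inE (xi0 pd d_odd) tr_sigma normr1 eqxx.
rewrite sum_lchar (L1_eq0 detG posG) !mulrA mulVf ?cardV_neq0 // mul1r.
case: eqP => [->|_]; last by rewrite mul0r.
by rewrite /L2 /= !sc0 (xi0 pd d_odd) tr_sigma mulr1.
Qed.

Lemma holevo_probe :
  holevo_vals (fun rho : op => boxprod G rho sigma) (ln #|S|%:R).
Proof.
have kn : #|{: V}|%:R != 0 :> R.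
  by rewrite card_V natrM mulf_neq0 // gt_eqF // (dn_gt0 pd).
(* The uniform ensemble over all characters: the average output has entropy [n ln d], each output
   [n ln d - ln #|S|]. *)
exists #|{: V}|, (fun=> (#|{: V}|%:R)^-1), (fun i => probe (enum_val i)).
have s1 (c : R) : \sum_(i < #|{: V}|) (#|{: V}|%:R)^-1 * c = c.
  by rewrite sumr_const card_ord -[_ *+ #|_|]mulr_natl mulrA mulfV // mul1r.
split=> [_||i|].
- by rewrite invr_ge0 ler0n.
- by rewrite -[RHS](s1 1); apply: eq_bigr => _ _; rewrite mulr1.
- exact: probe_state.
- under [X in _ - X]eq_bigr do rewrite vN_boxprod_probe.
  rewrite s1 -(big_enum_val (fun x => _ *: boxprod G (probe x) sigma)) avg_boxprod_probe.
  by rewrite vN_flat_state opprB addrC subrK.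
Qed.

(** The average output is a state of dimension [d ^ n], which bounds the first term, and each output
    has at least the entropy of [sigma] by [vN_boxprod]. *)
Lemma holevo_vals_ub x : holevo_vals (fun rho : op => boxprod G rho sigma) x ->
  x <= n%:R * ln d%:R - vN sigma.
Proof.
move=> [k [p [rho [p0 p1 rho_st ->]]]].
have prho i : psd (rho i) by have [] := rho_st i.
have trho i : \tr (rho i) = 1 by have [] := rho_st i.
apply: lerB.
  have -> : n%:R * ln d%:R = ln (dimq d n)%:R :> R.
    by rewrite (dimqE pd) natrX lnXn ?ltr0n ?prime_gt0 // mulr_natl.
  apply: vN_le_lnm; first by rewrite (dimqE pd) expn_gt0 prime_gt0.
    apply: psd_sum => i; apply: psdZ; first exact: p0.
    exact: (psd_boxprod detG (prho i) psd_sigma).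
  rewrite raddf_sum /= -[RHS](rmorph1 (real_complex R)) -p1 rmorph_sum; apply: eq_bigr => i _.
  by rewrite mxtraceZ (tr_boxprod pd d_odd detG) trho tr_sigma !mulr1.
rewrite -[X in X <= _]mul1r -p1 mulr_suml; apply: ler_sum => i _.
apply: ler_wpM2l; first exact: p0.
exact: (vN_boxprod pd d_odd detG posG (prho i) (trho i) psd_sigma).
Qed.

Lemma holevo_bounds :
  n%:R * ln (d%:R : R) - vN (meanState sigma)
     <= holevo (fun rho : op => boxprod G rho sigma)
     <= n%:R * ln (d%:R : R) - vN sigma.
Proof.
have isoS := isotropic_unimod pd d_odd psd_sigma tr_sigma.
have chS := unitary_char_unimod pd d_odd psd_sigma tr_sigma.
rewrite (meanStateE pd d_odd) (vN_stab pd d_odd isoS chS) opprB addrC subrK.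
apply/andP; split.
  (* The supremum dominates the probe value only once the set is known to be bounded above; the
     converse bound needs it to be nonempty. *)
  apply: ub_le_sup holevo_probe.
  by exists (n%:R * ln d%:R - vN sigma) => x; exact: holevo_vals_ub.
apply: ge_sup; first by exists (ln #|S|%:R); exact: holevo_probe.
by move=> x; exact: holevo_vals_ub.
Qed.

End Ensemble.

(** * Minimal projections of abelian Weyl algebras *)

Section MSPS.
Context {R : realType} {d n : nat}.
Hypothesis pd : prime d.
Hypothesis d_odd : d != 2%N.
Notation qv := (qv d n).
Notation V := (qv * qv)%type.
Notation op := (op R d n).

Lemma wl_neq0 (x : V) : wl x != 0 :> op.
Proof.
apply/eqP => e; have := @wlN R d n pd d_odd x; rewrite e mul0mx => /(congr1 (@mxtrace _ _))/eqP.
by rewrite mxtrace0 mxtrace1 (dimqE pd) eq_sym (negPf (dn_neq0 pd)).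
Qed.

Lemma isotropic_abelian (S : {set V}) : abelian_weyl_group R S -> isotropic S.
Proof.
move=> [S0 SB Sc]; split=> // x y xS yS; apply: (@chi_symp_inj R) => //.
have := Sc x y xS yS; rewrite -/(wl x) -/(wl y) !(wlM pd d_odd) [y + x]addrC => /eqP.
by rewrite -subr_eq0 -scalerBl scaler_eq0 (negPf (wl_neq0 _)) orbF subr_eq0 => /eqP.
Qed.

(** The twisted stabilizer states [T x] are eigenvectors of [P] and sum to a multiple of the
    identity, so some eigenvalue is nonzero, hence 1. Rescaling that [T x] gives a nonzero
    projection below [P], equal to [P] by minimality. *)
Lemma minimal_proj_stab (S : {set V}) (P : op) : isotropic S -> minimal_proj S P ->
  exists x c, P = c *: stab S (lchar x).
Proof.
move=> isoS [[a eP] [PP _] Pn0 Pmin].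
pose T x : op := stab S (lchar x).
have chT x := @unitary_lchar R d n pd S x.
(* The eigenvalue of [P] on [T x]: each [wl y] acts there as the scalar [lchar x (- y)]. *)
pose k x := \sum_(y in S) a y * lchar x (- y) : R[i].
have PT x : P *m T x = k x *: T x.
  rewrite eP mulmx_suml scaler_suml; apply: eq_bigr => y yS.
  by rewrite -scalemxAl (wl_stab pd d_odd isoS (chT x)) // scalerA.
have TP x : T x *m P = k x *: T x.
  rewrite eP mulmx_sumr scaler_suml; apply: eq_bigr => y yS.
  by rewrite -scalemxAr (stab_wl pd d_odd isoS (chT x)) // scalerA.
have trT x : \tr (T x) = 1 := tr_stab pd d_odd isoS (chT x).
have Tn0 x : T x != 0.
  by apply/eqP => e; have /eqP := trT x; rewrite e mxtrace0 eq_sym oner_eq0.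
have [S0 _ _] := isoS.
have sumT : \sum_x T x = (#|{: V}|%:R / (d ^ n)%:R) *: 1%:M.
  apply: (xi_inj pd d_odd) => y; rewrite xi_sum xiZ (xi1 pd d_odd) mulrA divfK ?dn_neq0 //.
  under eq_bigr do rewrite (xi_stab pd d_odd).
  case yS: (y \in S); first by rewrite (sum_lchar pd).
  by rewrite big1 //; case: eqP => [y0|_]; rewrite ?mulr0 //; rewrite y0 S0 in yS.
have [x kx] : exists x, k x != 0.
  apply/existsP; rewrite -negb_forall; apply: contra Pn0 => /forallP h.
  have : P *m \sum_x T x = 0.
    by rewrite mulmx_sumr big1 // => x _; rewrite PT (eqP (h x)) scale0r.
  rewrite sumT -scalemxAr mulmx1 => /eqP; rewrite scaler_eq0 => /orP[|//].
  by rewrite mulf_eq0 invr_eq0 (negPf (dn_neq0 pd)) (negPf (cardV_neq0 pd)).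
have k1 : k x = 1.
  have : P *m (P *m T x) = P *m T x by rewrite mulmxA PP.
  rewrite PT -scalemxAr PT scalerA => /eqP.
  rewrite -subr_eq0 -scalerBl scaler_eq0 (negPf (Tn0 x)) orbF subr_eq0.
  by rewrite -{3}[k x]mulr1 => /eqP/(mulfI kx).
(* The nonzero eigenvalue of [T x] by [stabM]; dividing by it produces a projection. *)
pose c : R := #|S|%:R / (d ^ n)%:R.
have c0 : c%:C != 0.
  by rewrite fmorph_eq0 gt_eqF // divr_gt0 ?(cardS_gt0 isoS) ?(dn_gt0 pd).
pose Q := (c%:C)^-1 *: T x.
have algQ : in_weyl_alg S Q.
  exists (fun y => (c%:C)^-1 * ((d ^ n)%:R^-1 * lchar x y)).
  rewrite /Q /T /stab !scaler_sumr; apply: eq_bigr => y _.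
  by rewrite !scalerA mulrA.
have prQ : is_proj Q.
  split; last by rewrite /Q adj_scale -fmorphV conjc_real adj_stab.
  rewrite /Q -scalemxAl -scalemxAr (stabM pd d_odd isoS (chT x)) -/c; congr (_ *: _).
  by rewrite scalerA mulVf // scale1r.
have QP : Q *m P = Q by rewrite /Q -scalemxAl TP k1 scale1r.
exists x, (c%:C)^-1.
case: (Pmin Q algQ prQ QP) => [/eqP|//].
by rewrite scaler_eq0 invr_eq0 (negPf c0) (negPf (Tn0 x)).
Qed.

Lemma meanState_MSPS (sigma : op) : \tr sigma = 1 -> isMSPS sigma -> meanState sigma = sigma.
Proof.
move=> tr1 [S [P [/isotropic_abelian isoS minP es]]].
have [x [c eP]] := minimal_proj_stab isoS minP.
have chx := @unitary_lchar R d n pd S x.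
suff -> : sigma = stab S (lchar x) by apply: meanState_stab.
(* Stabilizer states have trace 1, so [\tr sigma = 1] forces the overall scalar to be 1. *)
have := tr1; rewrite es eP scalerA mxtraceZ (tr_stab pd d_odd isoS chx) mulr1 => ->.
by rewrite scale1r.
Qed.

End MSPS.

Lemma positive_odd d (G : 'M['F_d]_2) : positiveG G -> \det G != 0 -> d != 2%N.
Proof.
move=> posG detG; apply/eqP => d2; subst d.
have one (a : 'F_2) : a != 0 -> a = 1 by case: a => m; case: m => [|[|m]] hm //= _; apply/val_inj.
by move: detG; rewrite detE !(one _ (posG _ _)) subrr eqxx.
Qed.

Theorem mainTheorem15 (R : realType) (d n : nat) (G : 'M['F_d]_2) (sigma : op R d n) :
  prime d -> (1 <= n)%N -> positiveG G -> \det G != 0 -> is_state sigma ->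
  (n%:R * ln (d%:R : R) - vN (meanState sigma)
     <= holevo (fun rho : op R d n => boxprod G rho sigma)
     <= n%:R * ln (d%:R : R) - vN sigma)
  /\ (isMSPS sigma ->
      holevo (fun rho : op R d n => boxprod G rho sigma) = n%:R * ln (d%:R : R) - vN sigma).
Proof.
move=> pd _ posG detG [s1 s2 s3].
have d_odd := positive_odd posG detG.
have psd_sigma : psd sigma by [].
have bounds := holevo_bounds pd d_odd detG posG psd_sigma s3.
split=> // /(meanState_MSPS pd d_odd s3) e.
(* Since [sigma] is its own mean state, the two bounds coincide. *)
by apply/eqP; rewrite eq_le; move: bounds; rewrite e andbC.
Qed.
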